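(* Let $n,k$ be integers with $n\ge 2k\ge 10$, and let $\mathcal{F}\subset\binom{[n]}{k}$ be a non-trivial family having the Helly property. Then $$|\mathcal{F}|\le |\mathcal{T}(n,k)| = 1+\binom{n-k-1}{k-1}+\binom{n-2}{k-2}.$$
   Context: $[n]=\{1,\dots,n\}$ and $\binom{[n]}{k}$ is the collection of all $k$-element subsets of $[n]$. A family is intersecting if any two of its members have non-empty intersection. A family $\mathcal{F}\subset\binom{[n]}{k}$ is non-trivial if $\bigcap_{F\in\mathcal{F}}F=\emptyset$, i.e. no element of $[n]$ lies in all members of $\mathcal{F}$. $\mathcal{F}$ has the Helly property (is of Helly-type) if for every (non-empty) intersecting subfamily $\mathcal{F}_0\subset\mathcal{F}$ the total intersection $\bigcap_{F\in\mathcal{F}_0}F$ is non-empty. The family $\mathcal{T}(n,k)$ is defined as follows: fix $T_0\in\binom{[n]}{k}$ with $T_0\cap\{1,2\}=\{2\}$ and put $\mathcal{T}(n,k)=\{T_0\}\cup\{T\in\binom{[n]}{k}: 1\in T,\ T\cap T_0=\emptyset\}\cup\{T\in\binom{[n]}{k}:\{1,2\}\subset T\}$. *)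

(* Defs.v *)
From mathcomp Require Import all_boot.

Set Implicit Arguments.
Unset Strict Implicit.
Unset Printing Implicit Defensive.

(* The ground set [n] = {1, ..., n} is 'I_n: the ordinal i stands for the
   element i + 1. *)

Definition ksubsets (n k : nat) : {set {set 'I_n}} :=
  [set A : {set 'I_n} | #|A| == k].

(* For 1 <= j <= n this is the singleton {j} of [n]. *)
Definition elt (n j : nat) : {set 'I_n} := [set i : 'I_n | i.+1 == j].

Definition intersecting (n : nat) (F : {set {set 'I_n}}) : Prop :=
  forall A B : {set 'I_n}, A \in F -> B \in F -> A :&: B != set0.

(* The empty family is not non-trivial for n > 0: its intersection is setT. *)
Definition nontrivial (n : nat) (F : {set {set 'I_n}}) : Prop :=
  \bigcap_(A in F) A = set0.

Definition Helly (n : nat) (F : {set {set 'I_n}}) : Prop :=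
  forall F0 : {set {set 'I_n}},
    F0 \subset F -> F0 != set0 -> intersecting F0 ->
    \bigcap_(A in F0) A != set0.

Definition T_base (n k : nat) (T0 : {set 'I_n}) : Prop :=
  T0 \in ksubsets n k /\ T0 :&: (elt n 1 :|: elt n 2) = elt n 2.

(* T(n,k), as a function of the chosen T0. *)
Definition T_family (n k : nat) (T0 : {set 'I_n}) : {set {set 'I_n}} :=
  T0 |: ([set T in ksubsets n k | (elt n 1 \subset T) && (T :&: T0 == set0)]
         :|: [set T in ksubsets n k | elt n 1 :|: elt n 2 \subset T]).

(* Main.v *)
Require Import Defs.
From mathcomp Require Import all_boot.
From mathcomp Require Import all_order all_algebra zify.

Set Implicit Arguments.
Unset Strict Implicit.
Unset Printing Implicit Defensive.

(* By the Helly property every A in F has a point x contained in all members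
   of F that meet A in at least k - 2 > k / 2 points.  Remove members of F one
   at a time as long as some member has a (k-2)-subset lying in no other
   remaining member.  Paired with the complements of the removed sets, these
   subsets form a skew Bollobas system, so at most C(n-2, k-2) sets are removed.
   What cannot be removed is a union of star-like families with centres i, in
   which every A and every y in A other than i admit a member G with
   G :&: A = A :\ y.  A member T of F missing i meets such an A in at most one
   point, and deleting from the star the sets disjoint from T already makes the
   star removable.  The deleted sets A, taken with a suitable T for each centre
   i, yield pairs (A :\ i, A :|: T) forming a second skew system, of size at
   most C(n-k-1, k-1).  With two or more centres this can fail for a few sets:
   either for one set only, or the failures are compensated by (k-2)-sets that
   lie in no member of F and can be adjoined to the first system. *)

(** * Skew Bollobas inequality by the polynomial method *)

Section SkewBollobas.
Import Order.TTheory GRing.Theory Num.Theory.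
Local Open Scope ring_scope.

Definition node_poly (n : nat) (A : {set 'I_n}) : {poly rat} :=
  \prod_(t in A) ('X - (val t)%:R%:P).

Lemma size_node_poly n (A : {set 'I_n}) : size (node_poly A) = #|A|.+1.
Proof.
by rewrite /node_poly -big_enum size_prod_XsubC cardE.
Qed.

Lemma node_poly_eq0 n (A : {set 'I_n}) (x : 'I_n) :
  ((node_poly A).[(val x)%:R] == 0) = (x \in A).
Proof.
rewrite /node_poly horner_prod; apply/idP/idP.
  move=> /prodf_eq0[t tA]; rewrite hornerXsubC subr_eq0 eqr_nat.
  by move=> /eqP/val_inj ->.
move=> xA; apply/prodf_eq0; exists x => //.
by rewrite hornerXsubC subrr.
Qed.

(* The product is a polynomial of degree at most [b] in the coefficients of
   [p], so it is a combination of [C(a + b, a)] fixed monomials in them. *)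
Lemma prod_horner_factor (n a b N : nat) (p : 'I_N -> {poly rat})
    (B : 'I_N -> {set 'I_n}) :
    (forall i, (size (p i) <= a.+1)%N) -> (forall j, #|B j| = b) ->
  (\rank (\matrix_(i < N, j < N) \prod_(x in B j) (p i).[(val x)%:R])%R
     <= 'C(a + b, a))%N.
Proof.
move=> size_p card_B; set M := \matrix_(i, j) _.
pose I := [set t : b.-tuple 'I_a.+1 | sorted leq [seq \val i | i <- t]].
have cardI : #|I| = 'C(a + b, a).
  by rewrite card_sorted_tuples addnC -bin_sub ?leq_addl // addnK addnC.
pose le : rel 'I_a.+1 := relpre val leq.
have key_size (f : {ffun 'I_b -> 'I_a.+1}) : size (sort le (codom f)) == b.
  by rewrite size_sort size_codom card_ord.
pose key f := Tuple (key_size f).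
have keyI f : key f \in I.
  rewrite inE /= sorted_map; apply: sort_sorted => i j; exact: leq_total.
pose x j l := enum_val (cast_ord (esym (card_B j)) l).
have xP j (G : 'I_n -> rat) : \prod_(y in B j) G y = \prod_(l < b) G (x j l).
  rewrite big_enum_val (reindex (cast_ord (esym (card_B j)))) //.
  by exists (cast_ord (card_B j)) => l _; rewrite ?cast_ordK ?cast_ordKV.
pose P := \matrix_(i < N, c < #|I|) \prod_(s <- (enum_val c : b.-tuple _)) (p i)`_s.
pose Q := \matrix_(c < #|I|, j < N) \sum_(f | key f == enum_val c)
  \prod_(l < b) (val (x j l))%:R ^+ (f l) : 'M[rat]_(_, _).
suff -> : M = P *m Q by rewrite -cardI; apply: mulmx_max_rank.
apply/matrixP => i j; rewrite !mxE; rewrite xP.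
 under eq_bigr => l _.
  rewrite (horner_coef_wide _ (size_p i)); over.
rewrite bigA_distr_bigA (partition_big key (mem I)) //= big_enum_val /=.
apply: eq_bigr => c _; rewrite !mxE big_distrr /=; apply: eq_bigr => f /eqP <-.
rewrite big_split /=; congr (_ * _).
have -> : \prod_(s <- sort le (codom f)) (p i)`_s = \prod_(s <- codom f) (p i)`_s.
  by apply: perm_big; rewrite perm_sort.
by rewrite /codom /image_mem big_map big_enum.
Qed.

(** Entry (i, j) of the matrix vanishes exactly when the first set of pair i meets the complement of
    the second set of pair j. Skewness makes it triangular with nonzero diagonal, so its rank is
    [size s]. *)
Lemma skew_bollobas (n a b : nat) (s : seq ({set 'I_n} * {set 'I_n})) :
    (forall p, p \in s -> [/\ p.1 \subset p.2, #|p.1| = a & (#|p.2| + b = n)%N]) ->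
    pairwise (fun p q : {set 'I_n} * {set 'I_n} => ~~ (p.1 \subset q.2)) s ->
  (size s <= 'C(a + b, a))%N.
Proof.
move=> sP /(pairwiseP (set0, set0)) skew.
pose A (i : 'I_(size s)) := (nth (set0, set0) s i).1.
pose B (i : 'I_(size s)) := ~: (nth (set0, set0) s i).2.
have nthP (i : 'I_(size s)) := sP _ (mem_nth (set0, set0) (ltn_ord i)).
have cardA i : (size (node_poly (A i)) <= a.+1)%N.
  by rewrite size_node_poly; case: (nthP i) => _ ->.
have cardB i : #|B i| = b.
  have := cardsCs (B i); rewrite setCK card_ord => ->.
  by case: (nthP i) => _ _ /(canRL (addKn _)) <-.
have := prod_horner_factor cardA cardB; set M := \matrix_(i, j) _.
suff /mxrank_unit -> : M \in unitmx by [].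
have Mtrig : is_trig_mx M.
  apply/is_trig_mxP => i j ij; rewrite mxE; apply/eqP/prodf_eq0.
  have /subsetPn[x xA xB] := skew _ _ (ltn_ord i) (ltn_ord j) ij.
  by exists x; rewrite ?inE // node_poly_eq0.
rewrite unitmxE (det_trig Mtrig) unitfE; apply/prodf_neq0 => i _.
rewrite mxE; apply/prodf_neq0 => x xB; rewrite node_poly_eq0.
case: (nthP i) => /subsetP AS _ _; apply: contraTN xB => /AS xS.
by rewrite inE negbK.
Qed.

End SkewBollobas.

Lemma exists_subset (T : finType) (B : {set T}) (m : nat) :
  m <= #|B| -> exists2 A : {set T}, A \subset B & #|A| = m.
Proof.
rewrite -bin_gt0 -cards_draws => /card_gt0P[A]; rewrite inE => /andP[AB /eqP].
by exists A.
Qed.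

Lemma cardsD1_pred (T : finType) (A : {set T}) x : x \in A -> #|A :\ x| = #|A| - 1.
Proof. by move=> xA; rewrite (cardsD1 x A) xA addKn. Qed.

(** * Centres, cores and stars under the Helly property *)

Section HellyCores.

Variables (n k : nat) (F : {set {set 'I_n}}).
Hypotheses (k_gt4 : 4 < k) (card_F : forall A, A \in F -> #|A| = k).
Hypothesis hellyF : Helly F.

Lemma helly_common (P : pred {set 'I_n}) (A0 : {set 'I_n}) :
    A0 \in F -> P A0 ->
    (forall A B, A \in F -> B \in F -> P A -> P B -> A :&: B != set0) ->
  exists x, forall A, A \in F -> P A -> x \in A.
Proof.
move=> A0F PA0 Pcap.
have /set0Pn[x /bigcapP xP] : \bigcap_(A in [set A in F | P A]) A != set0.
  apply: hellyF.
  - by apply/subsetP => A; rewrite inE => /andP[].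
  - by apply/set0Pn; exists A0; rewrite inE A0F.
  - by move=> A B; rewrite !inE => /andP[AF PA] /andP[BF PB]; apply: Pcap.
by exists x => A AF PA; apply: xP; rewrite inE AF.
Qed.

Definition center (A : {set 'I_n}) (x : 'I_n) :=
  [forall G in F, (k - 2 <= #|G :&: A|) ==> (x \in G)].

Lemma centerP A x G :
  center A x -> G \in F -> k - 2 <= #|G :&: A| -> x \in G.
Proof. by move=> /forall_inP/(_ G) h /h /implyP. Qed.

(* Two sets meeting [A] in at least [k - 2 > k / 2] elements meet in [A]. *)
Lemma center_exists A : A \in F -> exists x, center A x.
Proof.
move=> AF; have [|G H GF HF GA HA|x xP] :=
    @helly_common (fun G => k - 2 <= #|G :&: A|) A AF.
- by rewrite setIid (card_F AF) leq_subr.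
- suff /set0Pn[x] : (G :&: A) :&: (H :&: A) != set0.
    by rewrite !inE => /andP[/andP[xG _] /andP[xH _]]; apply/set0Pn; exists x;
      rewrite inE xG.
  rewrite -card_gt0.
  have := subset_leq_card (_ : (G :&: A) :|: (H :&: A) \subset A).
  rewrite cardsU (card_F AF) subUset !subsetIr => /(_ isT).
  have := subset_leq_card (subsetIl (G :&: A) (H :&: A)).
  lia.
by exists x; apply/forall_inP => G GF; apply/implyP; apply: xP.
Qed.

(** Exactly the families in which no removal step is possible. *)
Definition core (R : {set {set 'I_n}}) :=
  [forall A in R, forall U : {set 'I_n}, (U \subset A) && (#|U| == k - 2) ==>
     [exists G in R, (G != A) && (U \subset G)]].

Definition star_core (i : 'I_n) (R : {set {set 'I_n}}) :=
  (R \subset F) && [forall A in R, (i \in A) &&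
     [forall y in A :\ i, exists G in R, G :&: A == A :\ y]].

(** Some other member [G] contains [A] minus [x] and [y]. Meeting [A] in at least [k - 2] points, it
    contains the centre [x], and it then misses [y] because [G] differs from [A]. *)
Lemma core_remove (R : {set {set 'I_n}}) A x y :
    R \subset F -> core R -> A \in R -> center A x -> y \in A -> y != x ->
  exists2 G, G \in R & G :&: A = A :\ y.
Proof.
move=> RF Rcore AR xA yA yx; have AF := subsetP RF _ AR.
have xinA : x \in A by apply: (centerP xA AF); rewrite setIid (card_F AF) leq_subr.
have cardU : #|A :\ y :\ x| = k - 2.
  by rewrite !cardsD1_pred ?(card_F AF) ?inE ?xinA 1?eq_sym ?yx // -subnDA.
have UA : A :\ y :\ x \subset A by rewrite !subDset !subsetU ?subxx ?orbT.
have /forall_inP/(_ _ AR)/forallP/(_ (A :\ y :\ x)) := Rcore.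
rewrite UA cardU eqxx /= => /exists_inP[G GR /andP[GA UG]]; exists G => //.
have GF := subsetP RF _ GR.
have xG : x \in G.
  by apply: (centerP xA GF); rewrite -cardU subset_leq_card // subsetI UG.
have AyG : A :\ y \subset G.
  apply/subsetP => t tA; have [-> //|tx] := eqVneq t x.
  by apply: (subsetP UG); rewrite in_setD1 tx.
have yG : y \notin G.
  apply: contra GA => yG; rewrite eq_sym eqEcard (card_F AF) (card_F GF) leqnn.
  by rewrite andbT -(setD1K yA) subUset sub1set yG.
apply/eqP; rewrite eqEsubset subsetI AyG subD1set !andbT.
by apply/subsetP => t; rewrite !inE => /andP[tG ->]; rewrite andbT; apply: contraTneq tG => ->.
Qed.

(** Keep the members with one common centre [i]. The point to check is that the [G] meeting [A] in
    [A :\ y] again has centre [i]. *)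
Lemma core_star (R : {set {set 'I_n}}) :
    R \subset F -> R != set0 -> core R ->
  exists i (R' : {set {set 'I_n}}), [/\ R' \subset R, R' != set0 & star_core i R'].
Proof.
move=> RF /set0Pn[A AR] Rcore; have AF := subsetP RF _ AR.
have [i iA] := center_exists AF.
exists i, [set G in R | center G i]; split.
- by apply/subsetP => G; rewrite inE => /andP[].
- by apply/set0Pn; exists A; rewrite inE AR.
apply/andP; split.
  by apply: subset_trans RF; apply/subsetP => G; rewrite inE => /andP[].
apply/forall_inP => {A AR AF iA} A; rewrite inE => /andP[AR iA].
have AF := subsetP RF _ AR.
have inA x : center A x -> x \in A.
  by move=> h; apply: (centerP h AF); rewrite setIid (card_F AF) leq_subr.
rewrite inA //=; apply/forall_inP => y; rewrite !inE => /andP[yi yA].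
have [G GR GA] := core_remove RF Rcore AR iA yA yi.
apply/exists_inP; exists G; last by rewrite GA.
rewrite inE GR /=; have GF := subsetP RF _ GR.
have [w wG] := center_exists GF.
have [<- // | wi] := eqVneq w i.
have cardAy : #|A :\ y| = k - 1.
  by rewrite cardsD1_pred ?(card_F AF).
have wAy : w \in A :\ y.
  rewrite -GA inE; apply/andP; split.
    by apply: (centerP wG GF); rewrite setIid (card_F GF) leq_subr.
  by apply: (centerP wG AF); rewrite setIC GA cardAy leq_sub2l.
have wA : w \in A by case/setD1P: wAy.
(* [H] misses [w] but still meets [G] in at least [k - 2] points, so it must contain the centre [w]
   of [G]. *)
have [H HR HA] := core_remove RF Rcore AR iA wA wi.
have HF := subsetP RF _ HR.
suff : w \in H :&: A by rewrite HA !inE eqxx.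
rewrite inE wA andbT; apply: (centerP wG HF).
have : A :\ y :\ w \subset H :&: G.
  apply/subsetP => t; rewrite !inE => /and3P[tw ty tA].
  have : t \in H :&: A by rewrite HA !inE tw.
  have : t \in G :&: A by rewrite GA !inE ty.
  by rewrite !inE => /andP[-> _] /andP[-> _].
move=> /subset_leq_card; apply: leq_trans.
by rewrite cardsD1_pred // cardAy -subnDA.
Qed.

(** Star cores with centre [i] are closed under union, so this is the largest one. *)
Definition stars (i : 'I_n) : {set {set 'I_n}} :=
  \bigcup_(R : {set {set 'I_n}} | star_core i R) R.

Lemma star_coreP i (R : {set {set 'I_n}}) A :
    star_core i R -> A \in R ->
  [/\ A \in F, i \in A &
      forall y, y \in A -> y != i -> exists2 G, G \in R & G :&: A = A :\ y].
Proof.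
move=> /andP[RF /forall_inP Rst] AR.
have /andP[iA /forall_inP rm] := Rst A AR; split=> //; first exact: subsetP RF _ AR.
move=> y yA yi; have yAi : y \in A :\ i by rewrite !inE yi.
have /exists_inP[G GR /eqP GA] := rm y yAi.
by exists G.
Qed.

Lemma starsP i A : A \in stars i ->
  [/\ A \in F, i \in A &
      forall y, y \in A -> y != i -> exists2 G, G \in stars i & G :&: A = A :\ y].
Proof.
move=> /bigcupP[R Rst AR]; have [AF iA rm] := star_coreP Rst AR; split=> //.
move=> y yA yi; have [G GR GA] := rm y yA yi; exists G => //.
by apply/bigcupP; exists R.
Qed.

(** [T] and the members through [j] that meet [T] form an intersecting family, as any two of the
    latter share [j]. *)
Lemma common_in_missed T j : T \in F -> j \notin T ->
  exists2 t, t \in T &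
    forall G, G \in F -> j \in G -> G :&: T != set0 -> t \in G.
Proof.
move=> TF jT.
have [|G H GF HF|t tP] := @helly_common
    (fun G => (G == T) || (j \in G) && (G :&: T != set0)) T TF.
- by rewrite eqxx.
- move=> /orP[/eqP->|/andP[jG GT]] /orP[/eqP->|/andP[jH HT]] //.
  + by rewrite setIid -card_gt0 (card_F TF); lia.
  + by rewrite setIC.
  + by apply/set0Pn; exists j; rewrite inE jG.
exists t; first by apply: tP; rewrite ?eqxx.
by move=> G GF jG GT; apply: tP; rewrite // jG GT orbT.
Qed.

(** Let [t] be the point given by [common_in_missed]. If [T] and [G] shared two points, a star
    member [H] with [H :&: G = G :\ t] would still meet [T], hence contain [t]. *)
Lemma stars_meet_missed T j G :
  G \in stars j -> T \in F -> j \notin T -> #|T :&: G| <= 1.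
Proof.
move=> Gj TF jT; rewrite leqNgt; apply/negP => /card_gt1P[x [y []]].
rewrite !inE => /andP[xT xG] /andP[yT yG] xy.
have [t tT tP] := common_in_missed TF jT; have [GF jG rm] := starsP Gj.
have tG : t \in G by apply: tP => //; apply/set0Pn; exists x; rewrite inE xG.
have tj : t != j by apply: contraNneq jT => <-.
have [H Hj HG] := rm t tG tj; have [HF jH _] := starsP Hj.
have inH z : z \in G -> z != t -> z \in H.
  by move=> zG zt; have : z \in H :&: G; [rewrite HG !inE zt | rewrite inE => /andP[]].
have tH : t \in H.
  apply: tP => //; apply/set0Pn; have [e|xt] := eqVneq x t.
    by exists y; rewrite inE yT inH // -e eq_sym.
  by exists x; rewrite inE xT inH.
by have : t \in H :&: G; [rewrite inE tH | rewrite HG !inE eqxx].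
Qed.

(** If all members of [R] met [T], they would share a point other than [i], but some member of [R]
    omits that point. *)
Lemma star_core_disjoint i (R : {set {set 'I_n}}) T :
    star_core i R -> R != set0 -> T \in F -> i \notin T ->
  exists2 A, A \in R & A :&: T == set0.
Proof.
move=> Rst /set0Pn[A AR] TF iT; have [t tT tP] := common_in_missed TF iT.
apply/exists_inP; apply: contraT => /exists_inPn meet.
have tR B : B \in R -> t \in B.
  by move=> BR; have [BF iB _] := star_coreP Rst BR; apply: tP => //; apply: meet.
have [AF iA rm] := star_coreP Rst AR.
have ti : t != i by apply: contraNneq iT => <-.
have [G GR GA] := rm t (tR A AR) ti.
by have : t \in G :&: A; [rewrite inE !tR | rewrite GA !inE eqxx].
Qed.

Lemma stars_avoid i j A : A \in stars i -> j != i ->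
  exists2 G, G \in stars i & j \notin G.
Proof.
move=> Ai ji; have [_ _ rm] := starsP Ai.
have [jA|] := boolP (j \in A); last by exists A.
have [G Gi GA] := rm j jA ji; exists G => //.
by apply/negP => jG; have : j \in G :&: A; [rewrite inE jG | rewrite GA !inE eqxx].
Qed.

(** If one set misses the other's centre, [stars_meet_missed] applies. Otherwise a star member [B]
    with [B :&: A = A :\ j] misses [j] and meets [G] in [i] only, so [A] and [G] share just [i] and
    [j]. *)
Lemma stars_cross i j A G : A \in stars i -> G \in stars j -> i != j ->
  #|(A :\ i) :&: G| <= 1.
Proof.
move=> Ai Gj ij; have [AF iA rmA] := starsP Ai; have [GF jG _] := starsP Gj.
have sub : (A :\ i) :&: G \subset A :&: G by rewrite setSI // subD1set.
have [jA|jA] := boolP (j \in A); last first.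
  by apply: leq_trans (stars_meet_missed Gj AF jA); apply: subset_leq_card.
have [iG|iG] := boolP (i \in G); last first.
  apply: leq_trans (stars_meet_missed Ai GF iG); rewrite setIC.
  by apply: subset_leq_card; rewrite setIS // subD1set.
have [|B Bi BA] := rmA j jA; first by rewrite eq_sym.
have [BF iB _] := starsP Bi.
have jB : j \notin B.
  by apply/negP => jB; have : j \in B :&: A; [rewrite inE jB | rewrite BA !inE eqxx].
have BG := stars_meet_missed Gj BF jB.
rewrite -(cards1 j); apply: subset_leq_card; apply/subsetP => x.
rewrite !inE => /andP[/andP[xi xA] xG]; apply: contraT => xj.
have xB : x \in B.
  by have : x \in B :&: A; [rewrite BA !inE xj | rewrite inE => /andP[]].
suff : 1 < #|B :&: G| by rewrite ltnNge BG.
by apply/card_gt1P; exists x, i; rewrite !inE xB xG iB iG xi.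
Qed.

(** [A :\ i] has [k - 1 > 2] points, and [G] and [T] cover at most one each. *)
Lemma stars_not_covered i j m A G T :
    A \in stars i -> G \in stars j -> T \in stars m -> i != j -> i != m ->
  ~~ (A :\ i \subset G :|: T).
Proof.
move=> Ai Gj Tm ij im; apply/negP => /setIidPl sub.
have [AF iA _] := starsP Ai.
have := stars_cross Ai Gj ij; have := stars_cross Ai Tm im.
have := cardsU ((A :\ i) :&: G) ((A :\ i) :&: T).
rewrite -setIUr sub cardsD1_pred // (card_F AF); lia.
Qed.


(** * Peeling and the two skew systems *)

(** Each chosen subset lies in no member that remains after its set is removed, so the order of
    removal makes the pairs skew. *)
Lemma peel (K : {set {set 'I_n}}) :
    (forall R : {set {set 'I_n}}, R \subset K -> R != set0 -> ~~ core R) ->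
  exists s : seq ({set 'I_n} * {set 'I_n}),
    [/\ size s = #|K|,
        forall p, p \in s -> [/\ p.2 \in K, p.1 \subset p.2 & #|p.1| = k - 2] &
        pairwise (fun p q : {set 'I_n} * {set 'I_n} => ~~ (p.1 \subset q.2)) s].
Proof.
have [m] := ubnP #|K|; elim: m K => // m IH K Km nocore.
have [->|K0] := eqVneq K set0; first by exists [::]; rewrite cards0.
have /forall_inPn[A AK /forallPn[U]] := nocore K (subxx _) K0.
rewrite negb_imply => /andP[/andP[UA /eqP cardU] /exists_inPn alone].
have KA : #|K :\ A| < m by move: Km; rewrite (cardsD1 A K) AK.
have [|s [sizes sP skew]] := IH _ KA.
  by move=> R RK; apply: nocore; apply: subset_trans RK (subD1set _ _).
exists ((U, A) :: s); split=> /=.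
- by rewrite sizes (cardsD1 A K) AK.
- move=> p; rewrite inE => /predU1P[-> //|/sP[]].
  by rewrite in_setD1 => /andP[_ ->].
- rewrite skew andbT; apply/allP => q /sP[]; rewrite in_setD1 => /andP[qA qK] _ _.
  by have := alone _ qK; rewrite qA.
Qed.

(* [D] collects extra pairs, put in front of those obtained by peeling. *)
Lemma coreless_bound (K : {set {set 'I_n}}) (D : seq ({set 'I_n} * {set 'I_n})) :
    K \subset F ->
    (forall R : {set {set 'I_n}}, R \subset K -> R != set0 -> ~~ core R) ->
    (forall p, p \in D -> [/\ p.1 \subset p.2, #|p.1| = k - 2 & #|p.2| = k]) ->
    (forall p A, p \in D -> A \in F -> ~~ (p.1 \subset A)) ->
    pairwise (fun p q : {set 'I_n} * {set 'I_n} => ~~ (p.1 \subset q.2)) D ->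
    k <= n ->
  size D + #|K| <= 'C(n - 2, k - 2).
Proof.
move=> KF nocore DP Dout Dskew kn; have [s [<- sP skew]] := peel nocore.
have -> : n - 2 = (k - 2) + (n - k) by lia.
rewrite -size_cat; apply: skew_bollobas.
  move=> p; rewrite mem_cat => /orP[/DP[? ? ->]|/sP[pK ? ?]]; first by rewrite subnKC.
  by rewrite (card_F (subsetP KF _ pK)) subnKC.
rewrite pairwise_cat Dskew skew !andbT; apply/allrelP => p q pD /sP[qK _ _].
exact: Dout pD (subsetP KF _ qK).
Qed.

(** The deleted sets, indexed with their centres; a set may occur under several centres, which only
    overestimates their number. *)
Definition star_index (T : 'I_n -> {set 'I_n}) : {set 'I_n * {set 'I_n}} :=
  [set p | (p.2 \in stars p.1) && (p.2 :&: T p.1 == set0)].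

(** A core left over would contain a star core, one of whose members is disjoint from [T i] and was
    therefore deleted. *)
Lemma coreless_off_stars (T : 'I_n -> {set 'I_n}) (R : {set {set 'I_n}}) :
    (forall i, T i \in F /\ i \notin T i) ->
    R \subset F :\: (snd @: star_index T) -> R != set0 -> ~~ core R.
Proof.
move=> TF; rewrite subsetD => /andP[RF Rdisj] R0; apply/negP => Rcore.
have [i [R' [R'R R'0 R'st]]] := core_star RF R0 Rcore.
have [Ti iT] := TF i.
have [A AR' AT] := star_core_disjoint R'st R'0 Ti iT.
have /(disjointFr Rdisj) : A \in R by apply: subsetP AR'.
rewrite (_ : A \in _) //; apply/imsetP; exists (i, A) => //.
by rewrite inE /= AT andbT; apply/bigcupP; exists R'.
Qed.

(** List [X0] before [X1]. Distinct pairs with the same centre [i] are always skew: [A] is disjoint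
    from [T i], so covering [A :\ i] by [G :|: T i] forces [A = G]. *)
Lemma star_index_bound (T : 'I_n -> {set 'I_n}) (X0 X1 : {set 'I_n * {set 'I_n}}) :
    (forall i, T i \in F) -> 2 * k <= n ->
    X0 \subset star_index T -> X1 \subset star_index T ->
    [disjoint X0 & X1] ->
    (forall p q, p \in X0 -> q \in X0 :|: X1 -> p.1 != q.1 ->
       ~~ (p.2 :\ p.1 \subset q.2 :|: T q.1)) ->
    (forall p q, p \in X1 -> q \in X1 -> p.1 = q.1) ->
  #|X0| + #|X1| <= 'C(n - k - 1, k - 1).
Proof.
move=> TF kn X0T X1T X01 X0P X1P.
have XP p : p \in X0 :|: X1 ->
    [/\ p.2 \in F, p.1 \in p.2 & p.2 :&: T p.1 = set0].
  move=> pX; have : p \in star_index T.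
    by case/setUP: pX => /(subsetP _ _) ->.
  by rewrite inE => /andP[/starsP[? ? _] /eqP].
pose E (p : 'I_n * {set 'I_n}) := (p.2 :\ p.1, p.2 :|: T p.1).
have same p q : p \in X0 :|: X1 -> q \in X0 :|: X1 -> p.1 = q.1 -> p != q ->
    ~~ (p.2 :\ p.1 \subset q.2 :|: T q.1).
  move=> /XP[pF pp pT] /XP[qF qq qT] e; apply: contra => sub.
  suff e2 : p.2 = q.2 by case: p q e e2 {pF pp pT qF qq qT sub} => [? ?] [? ?] /= -> ->.
  apply/eqP; rewrite eqEcard (card_F pF) (card_F qF) leqnn andbT.
  apply/subsetP => x xp; have [->|xp1] := eqVneq x p.1; first by rewrite e.
  have /(subsetP sub) : x \in p.2 :\ p.1 by rewrite !inE xp1.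
  rewrite inE => /orP[//|xT].
  by have : x \in p.2 :&: T p.1; [rewrite inE xp e | rewrite pT inE].
(* [p.2 :\ p.1] has [k - 1] points, the complement of [p.2 :|: T p.1] has [n - 2 * k]. *)
have -> : n - k - 1 = (k - 1) + (n - 2 * k) by lia.
have -> : #|X0| + #|X1| = size (map E (enum X0 ++ enum X1)).
  by rewrite size_map size_cat -!cardE.
apply: skew_bollobas.
  move=> _ /mapP[p pX ->]; have /XP[pF pp pT] : p \in X0 :|: X1.
    by move: pX; rewrite mem_cat !mem_enum inE.
  split=> /=.
  - by rewrite subsetU // subD1set.
  - by rewrite cardsD1_pred // (card_F pF).
  - by rewrite cardsU pT cards0 subn0 (card_F pF) (card_F (TF _)) addnn -mul2n subnKC.
rewrite pairwise_map.
have uX : uniq (enum X0 ++ enum X1).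
  rewrite cat_uniq !enum_uniq andbT /=; apply/hasPn => p; rewrite !mem_enum => pX1.
  by rewrite (disjointFl X01).
move: uX; rewrite uniq_pairwise !pairwise_cat => /and3P[u01 u0 u1].
have inX0 p : p \in enum X0 -> p \in X0 by rewrite mem_enum.
have inX1 p : p \in enum X1 -> p \in X1 by rewrite mem_enum.
have step p q : p \in X0 -> q \in X0 :|: X1 -> p != q ->
    ~~ (p.2 :\ p.1 \subset q.2 :|: T q.1).
  move=> pX qX pq; have [e|ne] := eqVneq p.1 q.1; last exact: X0P.
  by apply: same; rewrite // inE pX.
apply/and3P; split.
- apply/allrelP => p q /inX0 pX /inX1 qX /=; apply: step; rewrite ?inE ?qX ?orbT //.
  by apply: contraTneq pX => ->; rewrite (disjointFl X01).
- apply: (@sub_in_pairwise _ [in X0] _ _ _ _ _ u0); last by apply/allP.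
  by move=> p q pX qX /=; apply: step; rewrite ?inE ?qX.
- apply: (@sub_in_pairwise _ [in X1] _ _ _ _ _ u1); last by apply/allP.
  move=> p q pX qX /=; apply: same; rewrite ?inE ?pX ?qX ?orbT //.
  exact: X1P.
Qed.

(** * The final bound, by number and position of the stars *)

Definition blocked_chain (D : seq ({set 'I_n} * {set 'I_n})) :=
  [/\ forall p, p \in D -> [/\ p.1 \subset p.2, #|p.1| = k - 2 & #|p.2| = k],
      forall p A, p \in D -> A \in F -> ~~ (p.1 \subset A) &
      pairwise (fun p q : {set 'I_n} * {set 'I_n} => ~~ (p.1 \subset q.2)) D].

(** The members outside the star index contain no core. Each pair in [D] lowers the bound on their
    number by one and so pays for one more deleted set. *)
Lemma card_from_star_index (T : 'I_n -> {set 'I_n}) D m :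
    (forall i, T i \in F /\ i \notin T i) -> 2 * k <= n -> blocked_chain D ->
    #|star_index T| <= 1 + m + size D ->
  #|F| <= 1 + m + 'C(n - 2, k - 2).
Proof.
move=> TF kn [DP Dout Dskew] cardT.
rewrite -(cardsID (snd @: star_index T) F).
have kn' : k <= n by lia.
have cardI : #|F :&: snd @: star_index T| <= 1 + m + size D.
  apply: leq_trans cardT; apply: leq_trans (leq_imset_card snd (mem (star_index T))).
  by apply: subset_leq_card; apply: subsetIr.
apply: leq_trans (leq_add cardI (leqnn _)) _; rewrite -addnA leq_add2l.
by apply: coreless_bound => //; [exact: subsetDl | move=> R; exact: coreless_off_stars].
Qed.

(* The centre [l] is listed last; then the skew condition can only fail between
   [A] centred at [a] and [G] centred at [l], and [Q] contains all such [A]. *)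
Lemma two_stars_bound a l (T : 'I_n -> {set 'I_n}) (Q : {set {set 'I_n}}) D :
    a != l -> 2 * k <= n ->
    T l \in stars a -> (forall i, i != l -> T i \in stars l) ->
    (forall i, i \notin T i) ->
    (forall A G, A \in stars a -> A :&: T a = set0 ->
       G \in stars l -> G :&: T l = set0 -> A :\ a \subset G :|: T l -> A \in Q) ->
    blocked_chain D -> #|Q| <= (size D).+1 ->
  #|F| <= 1 + 'C(n - k - 1, k - 1) + 'C(n - 2, k - 2).
Proof.
move=> al kn Tl Tother Tavoid QP DP cardQ.
have TF i : T i \in F.
  by have [->|/Tother] := eqVneq i l; [move: Tl|] => /starsP[].
apply: (card_from_star_index (T := T) (D := D)) => //.
set X := star_index T.
pose X1 := [set p in X | p.1 == l].
pose X0 := [set p in X | (p.1 != l) && ~~ ((p.1 == a) && (p.2 \in Q))].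
have X01 : #|X0| + #|X1| <= 'C(n - k - 1, k - 1).
  apply: (star_index_bound TF) => //.
  - by apply/subsetP => p; rewrite inE => /andP[].
  - by apply/subsetP => p; rewrite inE => /andP[].
  - rewrite -setI_eq0; apply/eqP/setP => p; rewrite !inE.
    by case: (p.1 == l); rewrite ?andbF.
  - move=> p q pX0 qX pq; move: pX0.
    rewrite inE => /andP[]; rewrite inE => /andP[pst /eqP pT] /andP[pl pQ].
    have [qst /eqP qT] : q.2 \in stars q.1 /\ q.2 :&: T q.1 == set0.
      by apply/andP; case/setUP: qX; rewrite inE => /andP[]; rewrite inE.
    (* [stars_not_covered] needs [T q.1] in a star whose centre differs from [p.1]: that centre is
       [l] here, and [a] when [q] is centred at [l]. *)
    have [ql|/Tother Tq] := eqVneq q.1 l; last exact: stars_not_covered qst Tq pq pl.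
    have [pa|pa] := eqVneq p.1 a; last first.
      by apply: (stars_not_covered pst qst _ pq pa); rewrite ql.
    apply: contra pQ => sub; rewrite pa eqxx /=.
    by apply: (QP p.2 q.2); rewrite -?pa -?ql.
  - by move=> p q; rewrite !inE => /andP[_ /eqP->] /andP[_ /eqP->].
have cardX : X \subset X0 :|: X1 :|: [set (a, A) | A in Q].
  apply/subsetP => p pX; rewrite !in_setU.
  have [pl|pl] := eqVneq p.1 l; first by rewrite (_ : p \in X1) ?orbT // inE pX pl /=.
  have [/andP[/eqP pa pQ]|pQ] := boolP ((p.1 == a) && (p.2 \in Q)); last first.
    by rewrite (_ : p \in X0) // inE pX pl.
  by apply/orP; right; apply/imsetP; exists p.2 => //; case: p pa {pX pl pQ} => ? ? /= ->.
have := subset_leq_card cardX.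
have h1 := leq_card_setU (X0 :|: X1) [set (a, A) | A in Q].
have h2 := leq_card_setU X0 X1.
have h3 := leq_imset_card (fun A : {set 'I_n} => (a, A)) (mem Q).
move=> h; apply: leq_trans h _; apply: leq_trans h1 _.
have -> : 1 + 'C(n - k - 1, k - 1) + size D = 'C(n - k - 1, k - 1) + (size D).+1 by lia.
apply: leq_add; first exact: leq_trans h2 X01.
exact: leq_trans h3 cardQ.
Qed.

Lemma one_star_bound :
    nontrivial F -> 2 * k <= n ->
    (forall i j, stars i != set0 -> stars j != set0 -> i = j) ->
  #|F| <= 1 + 'C(n - k - 1, k - 1) + 'C(n - 2, k - 2).
Proof.
move=> ntF kn one.
have /fin_all_exists[T TF] (i : 'I_n) : exists A, A \in F /\ i \notin A.
  have : i \notin \bigcap_(A in F) A by rewrite ntF inE.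
  have [/exists_inP[A AF iA] _|/exists_inPn h /negP[]] :=
      boolP [exists A in F, i \notin A]; first by exists A.
  by apply/bigcapP => A AF; apply: contraT => iA; case/negP: (h A AF).
apply: (card_from_star_index (T := T) (D := [::])) => //.
(* The bound holds with one to spare: [X0] is the whole index and [X1] is empty. *)
rewrite addn0 add1n ltnW // ltnS -[#|_|]addn0 -[X in _ + X](cards0 ('I_n * {set 'I_n})%type).
apply: star_index_bound => //; first by move=> i; case: (TF i).
- by rewrite sub0set.
- by rewrite -setI_eq0 setI0.
- move=> p q pT; rewrite setU0 => qT /eqP[]; apply: one; apply/set0Pn.
    by move: pT; rewrite inE => /andP[? _]; exists p.2.
  by move: qT; rewrite inE => /andP[? _]; exists q.2.
- by move=> p q; rewrite inE.
Qed.

Lemma two_stars_choice a l F0 G0 :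
    F0 \in stars a -> l \notin F0 -> G0 \in stars l -> a \notin G0 ->
  exists T : 'I_n -> {set 'I_n},
    [/\ T l = F0, T a = G0, forall i, i != l -> T i \in stars l &
        forall i, i \notin T i].
Proof.
move=> F0a lF0 G0l aG0; have [F0F aF0 _] := starsP F0a.
have al : a != l by apply: contraNneq lF0 => <-.
have /fin_all_exists[T TP] (i : 'I_n) : exists A, i != l -> A \in stars l /\ i \notin A.
  (* A placeholder at [l], overridden by [F0] below. *)
  have [->|il] := eqVneq i l; first by exists G0.
  by have [A Al iA] := stars_avoid G0l il; exists A.
exists (fun i => if i == l then F0 else if i == a then G0 else T i); split.
- by rewrite eqxx.
- by rewrite (negPf al) eqxx.
- move=> i il; rewrite (negPf il); case: ifP => // _.
  by case: (TP i il).
- move=> i; case: eqVneq => [->//|il]; case: eqVneq => [->//|_].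
  by case: (TP i il).
Qed.

(** An [A] violating skewness avoids [G0], hence [l], and the [G] covering it avoids [F0], hence
    [a]. So [A] and [G] are disjoint, which leaves [A = F0]: a single failure, absorbed by the
    summand 1. *)
Lemma disjoint_stars_bound a l F0 G0 :
    2 * k <= n ->
    F0 \in stars a -> l \notin F0 -> G0 \in stars l -> a \notin G0 ->
    (forall A G, A \in stars a -> l \notin A -> G \in stars l -> a \notin G ->
       A :&: G = set0) ->
  #|F| <= 1 + 'C(n - k - 1, k - 1) + 'C(n - 2, k - 2).
Proof.
move=> kn F0a lF0 G0l aG0 disj.
have [T [Tl Ta Tother Tavoid]] := two_stars_choice F0a lF0 G0l aG0.
have [F0F aF0 _] := starsP F0a; have [G0F lG0 _] := starsP G0l.
have al : a != l by apply: contraNneq lF0 => <-.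
apply: (@two_stars_bound a l T [set F0] [::]) => //; first by rewrite Tl.
  move=> A G Aa AT Gl GT sub; rewrite inE; move: AT GT sub; rewrite Tl Ta => AG0 GF0 sub.
  have [AF aA _] := starsP Aa.
  have lA : l \notin A.
    by apply/negP => lA; have : l \in A :&: G0; [rewrite inE lA | rewrite AG0 inE].
  have aG : a \notin G.
    by apply/negP => aG; have : a \in G :&: F0; [rewrite inE aG | rewrite GF0 inE].
  rewrite eqEcard (card_F AF) (card_F F0F) leqnn andbT.
  apply/subsetP => x xA; have [->//|xa] := eqVneq x a.
  have /(subsetP sub) : x \in A :\ a by rewrite !inE xa.
  rewrite inE => /orP[xG|//].
  by have : x \in A :&: G; [rewrite inE xA | rewrite disj ?inE].
by rewrite cards1.
Qed.

(* A member of [F] through [e] in [G0], [d] in [F0] and [U0] avoids [a], hence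
   meets [F0] in [d] only.  So two members, one through [d] and one through
   [d'], sharing a point outside [F0] would form with [F0] an intersecting
   triple without a common point: for each [v], [d] or [d'] is blocked. *)
Lemma blocked_exists a l z F0 G0 :
    F0 \in stars a -> l \notin F0 -> G0 \in stars l -> a \notin G0 ->
    F0 :&: G0 = [set z] ->
  exists2 D, blocked_chain D & size D = #|~: (F0 :|: G0)|.
Proof.
move=> F0a lF0 G0l aG0 cap.
have [F0F aF0 _] := starsP F0a; have [G0F lG0 _] := starsP G0l.
have al : a != l by apply: contraNneq lF0 => <-.
have /andP[zF0 zG0] : (z \in F0) && (z \in G0) by rewrite -in_setI cap inE.
have za : z != a by apply: contraNneq aG0 => <-.
have zl : z != l by apply: contraNneq lF0 => <-.
have notboth x : x \in F0 -> x \in G0 -> x = z.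
  by move=> x1 x2; apply/set1P; rewrite -cap inE x1.
(* The size [k - 4] leaves room for [x] and [v] in the [k - 2] points of [W x v], and is positive,
   so [e] exists. *)
have [|U0 U0E cardU0] := @exists_subset _ (G0 :\ l :\ z) (k - 4).
  by rewrite !cardsD1_pred ?inE ?zl ?zG0 // (card_F G0F) -!subnDA leq_sub2l.
have U0G x : x \in U0 -> [/\ x \in G0, x != l & x != z].
  by move=> /(subsetP U0E); rewrite !inE => /and3P[-> -> ->].
have [e eU0] : exists e, e \in U0 by apply/set0Pn; rewrite -card_gt0 cardU0 subn_gt0.
have [d [d' []]] : exists d d', [/\ d \in F0 :\ a :\ z, d' \in F0 :\ a :\ z & d != d'].
  by apply/card_gt1P; rewrite !cardsD1_pred ?inE ?za ?zF0 // (card_F F0F) -!subnDA; clear -k_gt4; lia.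
rewrite !inE => /and3P[dz da dF0] /and3P[d'z d'a d'F0] dd'.
pose V := ~: (F0 :|: G0).
have VP v : v \in V -> [/\ v \notin F0 & v \notin G0].
  by rewrite !inE negb_or => /andP[].
pose W x v := v |: (x |: U0).
have cardW x v : x \in F0 -> x != z -> v \in V -> #|W x v| = k - 2.
  move=> xF0 xz /VP[vF0 vG0]; rewrite !cardsU1 cardU0.
  have xU0 : x \notin U0.
    by apply: contra xz => /U0G[xG0 _ _]; rewrite (notboth x).
  have -> : v \notin x |: U0.
    rewrite !inE negb_or; apply/andP; split; first by apply: contraNneq vF0 => ->.
    by apply: contra vG0 => /U0G[].
  by rewrite xU0 /=; clear -k_gt4; lia.
have Wa x v H : x \in F0 -> x != a -> x != z -> v \in V -> H \in F -> W x v \subset H ->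
    a \notin H /\ F0 :&: H = [set x].
  move=> xF0 xa xz vV HF WH; have [vF0 vG0] := VP v vV.
  have xH : x \in H by apply: (subsetP WH); rewrite !inE eqxx orbT.
  have eH : e \in H by apply: (subsetP WH); rewrite !inE eU0 !orbT.
  have [eG0 el ez] := U0G e eU0.
  (* If [a] were in [H], then [F0] and [H], both through [a] and meeting [G0], would share a point
     of [G0], which must be [z]. Meeting [G0] in [e] and [z], [H] would contain [l] too, and so at
     least [k + 1] points. *)
  have aH : a \notin H.
    apply/negP => aH; have [t tG0 tP] := common_in_missed G0F aG0.
    have tF0 : t \in F0 by apply: tP => //; apply/set0Pn; exists z; rewrite inE zF0.
    have zH : z \in H.
      rewrite -(notboth t tF0 tG0); apply: tP => //; apply/set0Pn.
      by exists e; rewrite inE eH.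
    have lH : l \in H.
      apply: contraT => lH; have := stars_meet_missed G0l HF lH.
      rewrite leqNgt => /card_gt1P[]; exists e, z.
      by rewrite !inE eH zH eG0 zG0 ez.
    have : W x v :|: [set a; l; z] \subset H.
      by rewrite subUset WH /= !subUset !sub1set aH lH zH.
    move=> /subset_leq_card; rewrite (card_F HF) cardsU cardW //.
    have -> : W x v :&: [set a; l; z] = set0.
      apply/setP => y; rewrite !inE; apply/negbTE/andP => -[yW].
      have xl : x != l by apply: contraTneq xF0 => ->.
      move=> /orP[/orP[]|] /eqP ye; move: yW; rewrite {}ye.
      - rewrite eq_sym (negPf (_ : v != a)); last by apply: contraNneq vF0 => ->.
        rewrite eq_sym (negPf xa) => /U0G[aG0' _ _].
        by rewrite aG0' in aG0.
      - rewrite eq_sym (negPf (_ : v != l)); last by apply: contraNneq vG0 => ->.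
        by rewrite eq_sym (negPf xl) => /U0G[_]; rewrite eqxx.
      - rewrite eq_sym (negPf (_ : v != z)); last by apply: contraNneq vG0 => ->.
        by rewrite eq_sym (negPf xz) => /U0G[_ _]; rewrite eqxx.
    rewrite cards0 subn0 -setUA cardsU1 cards2 !inE negb_or al.
    rewrite eq_sym za eq_sym zl; clear -k_gt4; lia.
  split=> //; apply/esym/eqP; rewrite eqEcard sub1set inE xF0 xH cards1 /=.
  by rewrite setIC; apply: stars_meet_missed F0a HF aH.
have one_blocked v : v \in V ->
    exists x, [/\ x \in F0, x != a, x != z & forall H, H \in F -> ~~ (W x v \subset H)].
  move=> vV.
  have [/exists_inP[H HF WH]|/exists_inPn h] := boolP [exists H in F, W d v \subset H];
    last by exists d.
  exists d'; split=> // H' H'F; apply/negP => WH'.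
  have [aH capH] := Wa d v H dF0 da dz vV HF WH.
  have [aH' capH'] := Wa d' v H' d'F0 d'a d'z vV H'F WH'.
  have vHH' : v \in H :&: H'.
    by rewrite inE (subsetP WH) ?(subsetP WH') // !inE eqxx.
  have inc (A B : {set 'I_n}) x : x \in A :&: B -> A :&: B != set0 by move=> h; apply/set0Pn; exists x.
  have h1 : F0 :&: H != set0 by apply: (inc _ _ d); rewrite capH inE.
  have h2 : F0 :&: H' != set0 by apply: (inc _ _ d'); rewrite capH' inE.
  have h3 := inc _ _ _ vHH'.
  have ne A : A \in F -> A :&: A != set0 by move=> AF; rewrite setIid -card_gt0 (card_F AF); clear -k_gt4; lia.
  have [|A B AF BF|x xP] :=
      @helly_common (fun A => [|| A == F0, A == H | A == H']) F0 F0F.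
  - by rewrite eqxx.
  - move=> /or3P[] /eqP eA /or3P[] /eqP eB; rewrite {A}eA {B}eB in AF BF *;
      [exact: ne | exact: h1 | exact: h2 | rewrite setIC; exact: h1 | exact: ne |
       exact: h3 | rewrite setIC; exact: h2 | rewrite setIC; exact: h3 | exact: ne].
  have xF0 : x \in F0 by apply: xP; rewrite ?eqxx.
  have xH : x \in H by apply: xP; rewrite ?eqxx ?orbT.
  have xH' : x \in H' by apply: xP; rewrite ?eqxx ?orbT.
  have : x \in F0 :&: H by rewrite inE xF0.
  have : x \in F0 :&: H' by rewrite inE xF0.
  by rewrite capH capH' !inE => /eqP-> /eqP e'; rewrite e' eqxx in dd'.
have /fin_all_exists[f fP] (v : 'I_n) : exists x, v \in V ->
    [/\ x \in F0, x != a, x != z & forall H, H \in F -> ~~ (W x v \subset H)].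
  have [/one_blocked[x xP]|_] := boolP (v \in V); last by exists v.
  by exists x.
(* [a] and [l] lie in [F0 :|: G0], so [v] is the only point of [V] in the second set; this gives
   skewness. *)
pose E v := (W (f v) v, W (f v) v :|: [set a; l]).
have aW v : v \in V -> [/\ a \notin W (f v) v & l \notin W (f v) v].
  move=> vV; have [xF0 xa xz _] := fP v vV; have [vF0 vG0] := VP v vV.
  split; rewrite !inE !negb_or; apply/and3P; split.
  - by apply: contraNneq vF0 => <-.
  - by rewrite eq_sym.
  - by apply: contra aG0 => /U0G[].
  - by apply: contraNneq vG0 => <-.
  - by apply: contraNneq lF0 => ->.
  - by apply/negP => /U0G[_]; rewrite eqxx.
exists [seq E v | v <- enum V]; last by rewrite size_map -cardE.
split.
- move=> p /mapP[v]; rewrite mem_enum => vV ->; have [xF0 xa xz _] := fP v vV.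
  have [aWv lWv] := aW v vV; split=> /=; first by rewrite subsetUl.
    exact: cardW.
  rewrite cardsU cards2 al cardW //.
  have -> : W (f v) v :&: [set a; l] = set0.
    by apply/eqP; rewrite setI_eq0 disjoint_sym disjoints_subset subUset !sub1set !in_setC aWv.
  by rewrite cards0 subn0; clear -k_gt4; lia.
- move=> p A /mapP[v]; rewrite mem_enum => vV -> AF /=.
  by have [_ _ _] := fP v vV; apply.
- rewrite pairwise_map.
  have := enum_uniq V; rewrite uniq_pairwise.
  apply: (@sub_in_pairwise _ [in V]) => [v w vV wV /= vw|]; last by apply/allP => v; rewrite mem_enum.
  have [xF0 _ _ _] := fP w wV; have [vF0 vG0] := VP v vV.
  apply/subsetPn; exists v; first by rewrite !inE eqxx.
  rewrite !inE !negb_or vw /= -andbA; apply/and4P; split.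
  + by apply: contraNneq vF0 => ->.
  + by apply: contra vG0 => /U0G[].
  + by apply: contraNneq vF0 => ->.
  + by apply: contraNneq vG0 => ->.
Qed.

(** An [A] violating skewness avoids [z], so it has a point [v] outside [F0], which lies in the
    covering [G]. By [stars_cross] there is only one such [v], so [A = v |: (F0 :\ z)]. There are at
    most as many such sets as blocked pairs. *)
Lemma crossing_stars_bound a l z F0 G0 :
    2 * k <= n ->
    F0 \in stars a -> l \notin F0 -> G0 \in stars l -> a \notin G0 ->
    F0 :&: G0 = [set z] ->
  #|F| <= 1 + 'C(n - k - 1, k - 1) + 'C(n - 2, k - 2).
Proof.
move=> kn F0a lF0 G0l aG0 cap.
have [T [Tl Ta Tother Tavoid]] := two_stars_choice F0a lF0 G0l aG0.
have [F0F aF0 _] := starsP F0a; have [G0F lG0 _] := starsP G0l.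
have al : a != l by apply: contraNneq lF0 => <-.
have /andP[zF0 zG0] : (z \in F0) && (z \in G0) by rewrite -in_setI cap inE.
have za : z != a by apply: contraNneq aG0 => <-.
have [D Dchain sizeD] := blocked_exists F0a lF0 G0l aG0 cap.
apply: (@two_stars_bound a l T [set v |: (F0 :\ z) | v in ~: (F0 :|: G0)] D) => //.
- by rewrite Tl.
- move=> A G Aa; rewrite Tl Ta => AG0 Gl GF0 sub.
  have [AF aA _] := starsP Aa.
  have zA : z \notin A.
    by apply/negP => zA; have : z \in A :&: G0; [rewrite inE zA | rewrite AG0 inE].
  have /subsetPn[v vA vF0z] : ~~ (A \subset F0 :\ z).
    apply/negP => /subset_leq_card; rewrite cardsD1_pred // (card_F AF) (card_F F0F).
    by clear -k_gt4; lia.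
  have vz : v != z by apply: contraNneq zA => <-.
  have vF0 : v \notin F0 by move: vF0z; rewrite !inE vz.
  have va : v != a by apply: contraNneq vF0 => ->.
  have vG : v \in G.
    have /(subsetP sub) : v \in A :\ a by rewrite !inE va.
    by rewrite inE (negPf vF0) orbF.
  apply/imsetP; exists v.
    rewrite !inE negb_or vF0; apply/negP => vG0.
    by have : v \in A :&: G0; [rewrite inE vA | rewrite AG0 inE].
  have cardv : #|v |: (F0 :\ z)| = k.
    by rewrite cardsU1 vF0z cardsD1_pred // (card_F F0F) subnKC //; clear -k_gt4; lia.
  apply/eqP; rewrite eqEcard cardv (card_F AF) leqnn andbT; apply/subsetP => x xA.
  rewrite !inE; have [//|xv] := eqVneq x v.
  have -> : x != z by apply: contraNneq zA => <-.
  have [->//|xa] := eqVneq x a.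
  rewrite /=; apply: contraT => xF0; have xG : x \in G.
    have /(subsetP sub) : x \in A :\ a by rewrite !inE xa.
    by rewrite inE (negPf xF0) orbF.
  have := stars_cross Aa Gl al; rewrite leqNgt => /card_gt1P[].
  by exists x, v; rewrite !inE xa xA xG va vA vG xv.
- by rewrite sizeD ltnW // ltnS leq_imset_card.
Qed.

Lemma helly_bound :
    nontrivial F -> 2 * k <= n ->
  #|F| <= 1 + 'C(n - k - 1, k - 1) + 'C(n - 2, k - 2).
Proof.
move=> ntF kn.
have [/existsP[a /existsP[l /and3P[al /set0Pn[A Aa] /set0Pn[B Bl]]]]|none] :=
    boolP [exists a, exists l, [&& a != l, stars a != set0 & stars l != set0]]; last first.
  apply: one_star_bound => // i j i0 j0; apply/eqP; apply: contraNT none => ij.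
  by apply/existsP; exists i; apply/existsP; exists j; rewrite ij i0.
have [|F0 F0a lF0] := stars_avoid Aa (j := l); first by rewrite eq_sym.
have [G0 G0l aG0] := stars_avoid Bl al.
(* The two cases: whether or not some members of the two stars, each missing the other's centre,
   meet. *)
pose P (p : {set 'I_n} * {set 'I_n}) :=
  [&& p.1 \in stars a, l \notin p.1, p.2 \in stars l, a \notin p.2 & p.1 :&: p.2 != set0].
have [/existsP[[F1 G1] /and5P[/= F1a lF1 G1l aG1 /set0Pn[z zI]]]|none] := boolP [exists p, P p].
  apply: (crossing_stars_bound (z := z) kn F1a lF1 G1l aG1).
  apply/esym/eqP; rewrite eqEcard sub1set zI cards1 /=.
  by apply: stars_meet_missed G1l _ lF1; case: (starsP F1a).
apply: (disjoint_stars_bound kn F0a lF0 G0l aG0) => F1 G1 F1a lF1 G1l aG1.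
apply/eqP; apply: contraNT none => FG; apply/existsP; exists (F1, G1).
by rewrite /P /= F1a lF1 G1l aG1.
Qed.

End HellyCores.

(** * The size of T(n,k) *)

Lemma card_ksubsets_between (n k : nat) (P Q : {set 'I_n}) :
    #|P| <= k -> [disjoint P & Q] ->
  #|[set T in ksubsets n k | (P \subset T) && (T :&: Q == set0)]|
    = 'C(n - #|P| - #|Q|, k - #|P|).
Proof.
move=> Pk PQ; pose S := [set A : {set 'I_n} | A \subset ~: (P :|: Q) & #|A| == k - #|P|].
have SP A : A \in S -> [/\ P :&: A = set0, A :&: Q = set0 & #|A| = k - #|P|].
  rewrite inE setCU subsetI -!disjoints_subset -!setI_eq0 => /andP[/andP[/eqP AP /eqP AQ] /eqP].
  by rewrite setIC.
have -> : n - #|P| - #|Q| = #|~: (P :|: Q)|.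
  rewrite (cardsCs (~: _)) setCK card_ord cardsU -subnDA.
  by move: PQ; rewrite -setI_eq0 => /eqP->; rewrite cards0 subn0.
rewrite -cards_draws -/S -(card_in_imset (f := fun A => P :|: A) (D := S)); last first.
  move=> A B /SP[PA _ _] /SP[PB _ _] /= e; apply/setP => x; move/setP/(_ x): e.
  move/setP/(_ x): PB; move/setP/(_ x): PA; rewrite !inE.
  by case: (x \in P) => //= -> ->.
apply: eq_card => T; apply/idP/imsetP.
  rewrite !inE => /and3P[/eqP cardT PT /eqP TQ]; exists (T :\: P).
    rewrite inE setCU subsetI subsetDr /= cardsD (setIidPr PT) cardT eqxx andbT.
    by rewrite -disjoints_subset -setI_eq0 setIDAC TQ set0D.
  by rewrite -[LHS](setID T P) (setIidPr PT).
move=> [A /SP[PA AQ cardA] ->]; rewrite !inE subsetUl setIUl AQ setU0.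
by rewrite cardsU PA cards0 subn0 cardA subnKC // eqxx setI_eq0.
Qed.

Lemma card_T_family (n k : nat) (T0 : {set 'I_n}) :
    1 < n -> 1 < k -> T_base k T0 ->
  #|T_family k T0| = 1 + 'C(n - k - 1, k - 1) + 'C(n - 2, k - 2).
Proof.
move=> n1 k1 [T0k cap].
have elt1 : elt n 1 = [set Ordinal (ltnW n1)] by apply/setP => i; rewrite !inE eqSS.
have elt2 : elt n 2 = [set Ordinal n1] by apply/setP => i; rewrite !inE eqSS.
set o1 := Ordinal (ltnW n1) in elt1; set o2 := Ordinal n1 in elt2.
have card12 : #|[set o1; o2]| = 2 by rewrite cards2.
rewrite elt1 elt2 in cap; have /eqP cardT0 : #|T0| == k by rewrite inE in T0k.
have o2T0 : o2 \in T0 by move/setP/(_ o2): cap; rewrite !inE eqxx orbT andbT.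
have o1T0 : o1 \notin T0 by apply/negP => h; move/setP/(_ o1): cap; rewrite !inE h eqxx.
rewrite /T_family elt1 elt2 cardsU1 cardsU.
rewrite card_ksubsets_between ?cards1 ?disjoints1 //; last exact: ltnW.
have -> : [set T in ksubsets n k | [set o1; o2] \subset T] =
          [set T in ksubsets n k | ([set o1; o2] \subset T) && (T :&: set0 == set0)].
  by apply/setP => T; rewrite !inE setI0 eqxx andbT.
rewrite card_ksubsets_between ?card12 ?cards0 ?subn0 //; last by rewrite -setI_eq0 setI0.
(* A set containing [o2], a point of [T0], is not disjoint from [T0]. *)
rewrite cardT0 (_ : _ :&: _ = set0) ?cards0 ?subn0; last first.
  apply/setP => T; rewrite !inE; apply/negbTE/negP.
  rewrite subUset !sub1set => /andP[/and3P[_ _ /eqP/setP/(_ o2) TT0] /and3P[_ /andP[_ o2T] _]].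
  by move: TT0; rewrite !inE o2T o2T0.
rewrite !inE subUset !sub1set (negPf o1T0) !andbF /= -addnA -!subnDA.
by rewrite (addnC 1 k).
Qed.

Theorem theorem1p9 (n k : nat) (F : {set {set 'I_n}}) (T0 : {set 'I_n})
  (hk : 10 <= 2 * k) (hn : 2 * k <= n)
  (hF : F \subset ksubsets n k) (hnt : nontrivial F) (hH : Helly F)
  (hT0 : T_base k T0) :
  #|F| <= #|T_family k T0| /\
  #|T_family k T0| = 1 + 'C(n - k - 1, k - 1) + 'C(n - 2, k - 2).
Proof.
have k4 : 4 < k by lia.
have [n1 k1] : 1 < n /\ 1 < k by split; lia.
have cardT := card_T_family n1 k1 hT0; split=> //; rewrite cardT.
apply: helly_bound => // A AF; apply/eqP.
by move/subsetP/(_ A AF): hF; rewrite inE.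
Qed.
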